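(* Suppose that $(A, +, 0)$ is an abelian group, $S \subseteq A \setminus \{0\}$, $r > 1$ is an integer, and $S$ is weakly $r$-free. Then $\chi(\mathrm{Cay}(A, S)) \leq r$.
   Context: For an abelian group $(A,+,0)$ and $S\subseteq A\setminus\{0\}$ (not necessarily generating $A$), the Cayley graph $\mathrm{Cay}(A,S)$ has vertex set $A$, with distinct $x,y$ adjacent iff $y-x\in S\cup(-S)$. For an integer $r>1$, $S$ is weakly $r$-free if whenever $s_1,\dots,s_k\in S$, $m_1,\dots,m_k\in\mathbb{Z}$ and $\sum_{j=1}^k m_js_j=0$, it follows that $\sum_{j=1}^k m_j\equiv 0\pmod r$. *)

(* Defs.v *)
From mathcomp Require Import all_boot all_order all_algebra.
From mathcomp Require Import boolp classical_sets constructive_ereal.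

Set Implicit Arguments.
Unset Strict Implicit.
Unset Printing Implicit Defensive.

Import Order.TTheory GRing.Theory Num.Theory.
Local Open Scope classical_set_scope.
Local Open Scope ring_scope.

(* Simple graphs, with a possibly infinite vertex set. *)
Record sgraph := SGraph {
  vertex :> Type;
  adj : vertex -> vertex -> Prop;
  adj_sym : forall x y, adj x y -> adj y x;
  adj_irrefl : forall x, ~ adj x x }.

Definition proper_coloring (G : sgraph) (C : Type) (c : G -> C) : Prop :=
  forall x y, adj x y -> c x <> c y.

Definition colorable (G : sgraph) (n : nat) : Prop :=
  exists c : G -> 'I_n, proper_coloring c.

(* Every infinite chromatic number is represented by +oo. *)
Definition chromatic_number (G : sgraph) : \bar int :=
  if pselect (exists n, `[< colorable G n >]) is left ex_n
  then (ex_minn ex_n)%:Z%:E else +oo%E.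

Section Cayley.
Variables (A : zmodType) (S : set A).

Definition cayley_adj (x y : A) : Prop :=
  x <> y /\ (S `|` -%R @` S) (y - x).

Lemma cayley_adj_sym x y : cayley_adj x y -> cayley_adj y x.
Proof.
move=> [xy Sxy]; split; first by move=> yx; apply: xy.
case: Sxy => [Sxy|[s Ss sxy]]; first by right; exists (y - x); rewrite ?opprB.
by left; rewrite -opprB -sxy opprK.
Qed.

Lemma cayley_adj_irrefl x : ~ cayley_adj x x.
Proof. by case. Qed.

Definition Cay : sgraph := SGraph cayley_adj_sym cayley_adj_irrefl.

(* The s_j need not be distinct. *)
Definition weakly_free (r : int) : Prop :=
  forall (k : nat) (s : 'I_k -> A) (m : 'I_k -> int),
    (forall j, S (s j)) -> \sum_(j < k) s j *~ m j = 0 ->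
    (\sum_(j < k) m j = 0 %[mod r])%Z.

End Cayley.

(* Main.v *)
Require Import Defs.
From mathcomp Require Import all_boot all_order all_algebra.
From mathcomp Require Import boolp classical_sets constructive_ereal.

Import Order.TTheory GRing.Theory Num.Theory.
Local Open Scope classical_set_scope.
Local Open Scope ring_scope.

(** Weak [r]-freeness says that the coefficient sum of an integer combination
    of elements of [S] is determined modulo [r] by its value.  Choose a
    representative in each coset of the subgroup generated by [S], and colour
    [x] by the coefficient sum modulo [r] of its difference with the
    representative of its coset.  Adjacent vertices lie in the same coset and
    their colours differ by [1] or [-1], which is nonzero modulo [r]. *)

(** A relation, not a function: one [x] may have many weights, and weak freeness only forces them to
    agree modulo [r]. *)
Definition combination_of_weight {A : zmodType} (S : set A) (x : A) (n : int) :
  Prop :=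
  exists (k : nat) (s : 'I_k -> A) (m : 'I_k -> int),
    [/\ forall j, S (s j), x = \sum_(j < k) s j *~ m j & n = \sum_(j < k) m j].

Section Combinations.
Context {A : zmodType} {S : set A}.
Local Notation comb := (combination_of_weight S).

Lemma combination0 : comb 0 0.
Proof.
by exists 0%N, (fun=> 0), (fun=> 0); split=> [[]//||]; rewrite big_ord0.
Qed.

Lemma combination1 s : S s -> comb s 1.
Proof.
move=> Ss; exists 1%N, (fun=> s), (fun=> 1); split=> //.
  by rewrite big_ord1 mulr1z.
by rewrite big_ord1.
Qed.

Lemma combinationN x n : comb x n -> comb (- x) (- n).
Proof.
move=> [k [s [m [Ss -> ->]]]]; exists k, s, (fun j => - m j); split=> //.
  by rewrite -sumrN; apply: eq_bigr => j _; rewrite mulrNz.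
by rewrite sumrN.
Qed.

Lemma combinationD x y n p : comb x n -> comb y p -> comb (x + y) (n + p).
Proof.
move=> [k [s [m [Ss -> ->]]]] [l [t [q [St -> ->]]]].
exists (k + l)%N.
exists (fun i => match split i with inl a => s a | inr b => t b end).
exists (fun i => match split i with inl a => m a | inr b => q b end).
split; first by move=> j; case: (split j).
  rewrite big_split_ord; congr (_ + _); apply: eq_bigr => j _.
    by have /= -> := unsplitK (inl j : 'I_k + 'I_l).
  by have /= -> := unsplitK (inr j : 'I_k + 'I_l).
rewrite big_split_ord; congr (_ + _); apply: eq_bigr => j _.
  by have /= -> := unsplitK (inl j : 'I_k + 'I_l).
by have /= -> := unsplitK (inr j : 'I_k + 'I_l).
Qed.

Lemma combinationB x y n p : comb x n -> comb y p -> comb (x - y) (n - p).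
Proof. by move=> xn /combinationN; apply: combinationD. Qed.

(** Subtracting the two combinations writes [0] with weight [n - p]. *)
Lemma weakly_free_weight_eq r x n p :
  weakly_free S r -> comb x n -> comb x p -> (n = p %[mod r])%Z.
Proof.
move=> hfree xn xp; have := combinationB _ _ _ _ xn xp.
rewrite subrr => -[k [s [m [Ss /esym /(hfree _ _ _ Ss) + np]]]].
by rewrite -np mod0z => np0; apply/eqP; rewrite eqz_mod_dvd; apply/dvdz_mod0P.
Qed.

Definition coset_of_span (x : A) : set A := [set y | exists n, comb (x - y) n].

Definition coset_repr (x : A) : A := xget 0 (coset_of_span x).

Lemma coset_reprP x : exists n, comb (x - coset_repr x) n.
Proof.
(* The default [0] of [xget] is never reached: [x] lies in its own coset, by the empty
   combination. *)
rewrite /coset_repr; case: xgetP => [y _ //|/(_ x) []].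
by exists 0; rewrite subrr; apply: combination0.
Qed.

(** The two cosets are equal as sets, so [xget] makes the same choice in both. *)
Lemma coset_repr_eq x y n : comb (y - x) n -> coset_repr x = coset_repr y.
Proof.
move=> yx; congr (xget 0 _); apply/seteqP; split=> z /= [p zp].
  by exists (n + p); rewrite -(subrKA x); apply: combinationD.
exists (- n + p); rewrite -(subrKA y); apply: combinationD => //.
by rewrite -opprB; apply: combinationN.
Qed.

(** Let [f x] be a chosen weight of [x - coset_repr x]. Within a coset the representatives cancel,
    so [f y - f x] and [n] are both weights of [y - x]. *)
Lemma weakly_free_potential r : weakly_free S r ->
  exists f : A -> int,
    forall x y n, comb (y - x) n -> (f y - f x = n %[mod r])%Z.
Proof.
move=> hfree; have [f fP] := choice coset_reprP.
exists f => x y n yxn; apply: (weakly_free_weight_eq _ _ _ _ hfree _ yxn).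
have := combinationB _ _ _ _ (fP y) (fP x).
by rewrite (coset_repr_eq _ _ _ yxn) opprB addrA subrK.
Qed.

End Combinations.

Lemma cayley_adj_combination {A : zmodType} (S : set A) (x y : A) :
  cayley_adj S x y ->
  exists2 e : int, `|e| = 1 & combination_of_weight S (y - x) e.
Proof.
case=> _ [Syx|[s Ss <-]]; first by exists 1 => //; apply: combination1.
by exists (- 1) => //; apply/combinationN/combination1.
Qed.

Lemma chromatic_number_le (G : sgraph) n :
  colorable G n -> (chromatic_number G <= n%:Z%:E)%E.
Proof.
rewrite /chromatic_number => Gn; case: pselect => [ex_n|[]]; last first.
  by exists n; apply/asboolP.
by case: ex_minnP => m _ mP; rewrite lee_fin lez_nat; apply: mP; apply/asboolP.
Qed.

Theorem theorem3p2p1 (A : zmodType) (S : set A) (hS : S `<=` ~` [set 0])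
  (r : int) (hr : 1 < r) (hfree : weakly_free S r) :
  (chromatic_number (Cay S) <= r%:E)%E.
Proof.
case: r hr hfree => // r hr hfree; apply: chromatic_number_le.
have r_gt0 : (0 : int) < r by apply: lt_trans hr.
have [f fP] := weakly_free_potential _ hfree.
have color_lt x : (`|(f x %% r)%Z|%N < r)%N.
  by rewrite -ltz_nat gez0_abs ?modz_ge0 ?gt_eqF// ltz_pmod.
exists (fun x : A => Ordinal (color_lt x)) => x y.
move=> /cayley_adj_combination [e e1 /fP fxy] [/(congr1 Posz)].
(* Equal colours make [r] divide [f y - f x], hence also [e], which forces [r = 1]. *)
rewrite !gez0_abs ?modz_ge0 ?gt_eqF// => /esym/eqP.
rewrite eqz_mod_dvd => /dvdz_mod0P; rewrite fxy => /dvdz_mod0P.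
rewrite dvdzE.
have -> : `|e|%N = 1%N by apply/eqP; rewrite -eqz_nat abszE e1.
by rewrite dvdn1 => /eqP r1; move: hr; rewrite ltz_nat -[r]/(absz r) r1.
Qed.
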